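(* Let $X$ be an infinite set and let $\mathcal{R}$ be the subring of $\mathcal{P}(X)$ consisting of all subsets of $X$ which are either finite or cofinite. Then $\operatorname{Spec}(\mathcal{R})$, together with the map $\eta:X\to\operatorname{Spec}(\mathcal{R})$ given by $x\mapsto\mathfrak{m}_x\cap\mathcal{R}$, is the Alexandroff compactification of the discrete space $X$.
   Context: $\mathcal{P}(X)$ denotes the power set ring of $X$: the set of all subsets of $X$ with addition $A+B=(A\cup B)\setminus(A\cap B)$ and multiplication $A\cdot B=A\cap B$. A subset is cofinite if its complement in $X$ is finite. For $x\in X$, $\mathfrak{m}_x=\mathcal{P}(X\setminus\{x\})$, a maximal ideal of $\mathcal{P}(X)$. $\operatorname{Spec}$ carries the Zariski topology. A compact space means a quasi-compact Hausdorff space. A compactification of a topological space $X$ is a compact space $\widetilde X$ together with an open embedding (a continuous injective open map) $\eta:X\to\widetilde X$ such that $\eta(X)$ is dense in $\widetilde X$. If moreover $\widetilde X\setminus\eta(X)$ consists of a single point, then $\widetilde X$ is called the Alexandroff (one-point) compactification of $X$. *)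

(* Defs.v *)
From HB Require Import structures.
From mathcomp Require Import all_boot all_order all_algebra.
From mathcomp Require Import all_classical all_reals all_analysis.

Set Implicit Arguments.
Unset Strict Implicit.
Unset Printing Implicit Defensive.

Import GRing.Theory.

Local Open Scope classical_set_scope.
Local Open Scope ring_scope.

(* The library's ideals ([idealr], [prime_idealr]) only exist over nontrivial
   rings, whereas the power set ring of an arbitrary [X] may be the zero ring;
   hence a set-based definition over [comPzRingType]. *)
Record prime_ideal (R : comPzRingType) (I : set R) : Prop := PrimeIdeal {
  ideal0 : I 0;
  idealD : forall a b, I a -> I b -> I (a + b);
  idealM : forall a b, I b -> I (a * b);
  ideal_proper : ~ I 1;
  ideal_prime : forall a b, I (a * b) -> I a \/ I b }.

Definition Spec (R : comPzRingType) : Type :=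
  set_type [set I : set R | prime_ideal I].

Definition ideal_of (R : comPzRingType) (p : Spec R) : set R := val p.

Lemma ideal_ofP (R : comPzRingType) (p : Spec R) : prime_ideal (ideal_of p).
Proof. by have := valP p; rewrite inE. Qed.

Definition MkSpec (R : comPzRingType) (I : set R) (hI : prime_ideal I) :
  Spec R := exist _ I (mem_set hI).

Definition zariski_V (R : comPzRingType) (E : set R) : set (Spec R) :=
  [set p | E `<=` ideal_of p].

Definition zariski_open (R : comPzRingType) : set (set (Spec R)) :=
  [set U | exists E : set R, U = ~` zariski_V E].

Lemma zariski_openT (R : comPzRingType) : @zariski_open R setT.
Proof.
exists [set 1]; apply/esym; rewrite -subTset => p _ /(_ 1 erefl).
exact: (ideal_proper (ideal_ofP p)).
Qed.

Lemma zariski_openI (R : comPzRingType) : setI_closed (@zariski_open R).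
Proof.
move=> _ _ [E ->] [F ->].
exists [set a * b | a in E & b in F]; rewrite -setCU; congr (~` _).
apply/seteqP; split=> [p Vp _ [a Ea [b Fb <-]]|p Vp].
  have hp := ideal_ofP p; case: Vp => [/(_ _ Ea)|/(_ _ Fb)] h.
    by rewrite mulrC; exact: (idealM hp).
  exact: (idealM hp).
have [/= ?|/= /existsNP[a /not_implyP[Ea nIa]]] := pselect (E `<=` ideal_of p).
  by left.
right=> b Fb; have /(ideal_prime (ideal_ofP p))[//|//] : ideal_of p (a * b).
by apply: Vp; exists a => //; exists b.
Qed.

Lemma zariski_open_bigU (R : comPzRingType) (I : Type) (f : I -> set (Spec R)) :
  (forall i, zariski_open (f i)) -> zariski_open (\bigcup_i f i).
Proof.
move=> /choice[E fE]; exists (\bigcup_i E i).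
rewrite (eq_bigcupr (fun i _ => fE i)) -setC_bigcap; congr (~` _).
apply/seteqP; split=> [p Vp a [i _ Eia]|p Vp i _ a Eia]; first exact: (Vp i).
by apply: Vp; exists i.
Qed.

HB.instance Definition _ (R : comPzRingType) := Choice.on (Spec R).
HB.instance Definition _ (R : comPzRingType) := isOpenTopological.Build (Spec R)
  (@zariski_openT R) (@zariski_openI R) (@zariski_open_bigU R).

Lemma openZariskiE (R : comPzRingType) (U : set (Spec R)) :
  open U = zariski_open U.
Proof. by []. Qed.

(* An alias of [set X], so that the ring structure is not attached to all
   sets. By [setYE], [A `+` B] is [(A `|` B) `\` (A `&` B)]. *)
Definition powerset_ring (X : Type) : Type := set X.

Lemma powerset_addN (X : Type) : left_inverse set0 (@id (set X)) (@setY X).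
Proof. exact: setYK. Qed.

HB.instance Definition _ (X : Type) := Choice.copy (powerset_ring X) (set X).
HB.instance Definition _ (X : Type) := GRing.isZmodule.Build (powerset_ring X)
  (@setYA X) (@setYC X) (@set0Y X) (@powerset_addN X).
HB.instance Definition _ (X : Type) :=
  GRing.Zmodule_isComPzRing.Build (powerset_ring X)
    (@setIA X) (@setIC X) (@setTI X) (@setIYl X).

Definition fincofin (X : Type) : {pred powerset_ring X} :=
  fun A => `[< finite_set (A : set X) \/ cofinite_set (A : set X) >].

Lemma fincofin_subring (X : Type) : subring_closed (@fincofin X).
Proof.
split=> [|A B|A B].
- by apply/asboolP; right; rewrite setCT; exact: finite_set0.
- rewrite !unfold_in => /asboolP hA /asboolP hB; apply/asboolP.
  change (finite_set ((A : set X) `+` B) \/ cofinite_set ((A : set X) `+` B)).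
  case: hA => hA; case: hB => hB.
  + left; apply: (@sub_finite_set _ _ ((A : set X) `|` B)).
      by move=> x [[]|[]]; [left|right].
    by rewrite finite_setU.
  + right; apply: (@sub_finite_set _ _ ((A : set X) `|` ~` B)).
      move=> x; rewrite setYE setCD => -[/not_orP[_ nB]|[Ax Bx]]; first by right.
      by left.
    by rewrite finite_setU.
  + right; apply: (@sub_finite_set _ _ (~` (A : set X) `|` B)).
      move=> x; rewrite setYE setCD => -[/not_orP[nA _]|[Ax Bx]]; first by left.
      by right.
    by rewrite finite_setU.
  + left; apply: (@sub_finite_set _ _ (~` (A : set X) `|` ~` B)).
      by move=> x [[]|[]]; [right|left].
    by rewrite finite_setU.
- rewrite !unfold_in => /asboolP hA /asboolP hB; apply/asboolP.
  change (finite_set ((A : set X) `&` B) \/ cofinite_set ((A : set X) `&` B)).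
  case: hA => hA; first by left; apply: sub_finite_set hA => x [].
  case: hB => hB; first by left; apply: sub_finite_set hB => x [].
  by right; rewrite setCI finite_setU.
Qed.

HB.instance Definition _ (X : Type) :=
  GRing.isSubringClosed.Build (powerset_ring X) (@fincofin X)
    (@fincofin_subring X).

Record fincofin_ring (X : Type) : Type := FinCofin {
  fincofin_val :> powerset_ring X;
  _ : fincofin_val \in @fincofin X }.

HB.instance Definition _ (X : Type) := [isSub for @fincofin_val X].
HB.instance Definition _ (X : Type) := [Choice of fincofin_ring X by <:].
HB.instance Definition _ (X : Type) :=
  GRing.SubChoice_isSubComPzRing.Build (powerset_ring X) _ (fincofin_ring X)
    (@fincofin_subring X).

Definition max_ideal_at (X : Type) (x : X) : set (powerset_ring X) :=
  [set A : set X | A `<=` [set~ x]].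

Lemma max_ideal_atE (X : Type) (x : X) (A : set X) :
  max_ideal_at x A <-> ~ A x.
Proof. by split=> [sA Ax|nAx y Ay yx]; [exact: (sA x)|apply: nAx; rewrite -yx]. Qed.

Lemma max_ideal_at_prime (X : Type) (x : X) : prime_ideal (max_ideal_at x).
Proof.
split=> [|A B|A B||A B]; rewrite ?max_ideal_atE.
- by [].
- by move=> nA nB [[]|[]].
- by move=> nB [].
- exact.
- by move=> /not_andP.
Qed.

Lemma contraction_prime (R S : comPzRingType) (f : {rmorphism S -> R})
  (I : set R) : prime_ideal I -> prime_ideal (f @^-1` I).
Proof.
move=> hI; split=> [|a b|a b||a b] /=.
- by rewrite rmorph0; exact: ideal0.
- by rewrite rmorphD; exact: idealD.
- by rewrite rmorphM; exact: idealM.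
- by rewrite rmorph1; exact: ideal_proper.
- by rewrite rmorphM; exact: ideal_prime.
Qed.

(* The preimage under the inclusion [val] is the intersection of
   [max_ideal_at x] with the subring. *)
Definition eta (X : choiceType) (x : discrete_topology X) :
    Spec (fincofin_ring X) :=
  MkSpec (contraction_prime (val : {rmorphism fincofin_ring X -> powerset_ring X})
    (max_ideal_at_prime x)).

Definition compact_space (T : topologicalType) : Prop :=
  compact [set: T] /\ hausdorff_space T.

Definition open_embedding (S T : topologicalType) (f : S -> T) : Prop :=
  [/\ continuous f, injective f & forall U, open U -> open (f @` U)].

Definition compactification (S T : topologicalType) (f : S -> T) : Prop :=
  [/\ compact_space T, open_embedding f & dense (range f)].

Definition alexandroff_compactification (S T : topologicalType) (f : S -> T) :
    Prop :=
  compactification f /\ exists p : T, ~` range f = [set p].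

(* Main.v *)
Require Import Defs.
From mathcomp Require Import all_boot all_order all_algebra.
From mathcomp Require Import all_classical all_reals all_analysis.

(** Every element of the ring R of finite and cofinite subsets is idempotent,
    so that the basic Zariski open sets D(a) and D(1 - a) partition Spec R.
    This makes Spec R Hausdorff ([idempotent_Spec_hausdorff]).

    The points of Spec R can be listed. If a prime p misses some singleton
    {x}, then p is the ideal of the sets avoiding x: for A in R, the product
    A * {x} is {x} or 0 according to whether x belongs to A. If p contains
    every singleton, then it contains every finite set, hence no cofinite one,
    and it is the ideal of the finite sets, which is proper because X is
    infinite. So Spec R consists of the image of eta and of this single extra
    point at infinity ([fincofin_prime_cases]).

    Every point eta x is isolated, because D({x}) = {eta x}; this gives an open
    embedding of the discrete space X. A basic neighbourhood D(A) of the point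
    at infinity is given by an infinite, hence cofinite, set A, and it omits
    only the finitely many points eta x with x outside A. A space with a point
    all of whose neighbourhoods are cofinite is compact
    ([compact_cofinite_nbhs]). Finally D(A) contains eta x as soon as x is in
    A, and every nonempty open set contains some D(A) with A nonempty, so the
    image of eta is dense. *)

Set Implicit Arguments.
Unset Strict Implicit.
Unset Printing Implicit Defensive.

Import GRing.Theory.

Local Open Scope classical_set_scope.
Local Open Scope ring_scope.

(** * Compactness from a point with cofinite neighbourhoods *)

(** A filter that does not cluster at p contains the complement of some
    neighbourhood of p, which is finite and therefore compact. *)
Lemma compact_cofinite_nbhs (T : topologicalType) (p : T) :
  (forall U, nbhs p U -> cofinite_set U) -> compact [set: T].
Proof.
move=> cofp F PF _; have [Fp|] := pselect (cluster F p); first by exists p.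
move=> /existsNP[G /existsNP[U /not_implyP[FG /not_implyP[pU GU0]]]].
have GU : G `<=` ~` U by move=> q Gq Uq; apply: GU0; exists q.
have /finite_compact cptU := cofp U pU.
have [q [_ Fq]] := cptU F PF (filterS GU FG).
by exists q.
Qed.

(** * Basic open sets and idempotents in the Zariski topology *)

Definition basic_open (R : comPzRingType) (a : R) : set (Spec R) :=
  [set p | ~ ideal_of p a].

Lemma open_basic (R : comPzRingType) (a : R) : open (basic_open a).
Proof.
rewrite openZariskiE; exists [set a]; congr (~` _).
by apply/seteqP; split=> [p pa _ ->//|p]; apply.
Qed.

Lemma nbhs_basic (R : comPzRingType) (p : Spec R) (U : set (Spec R)) :
  nbhs p U -> exists2 a, basic_open a p & basic_open a `<=` U.
Proof.
rewrite nbhsE => -[V [oV Vp] VU].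
move: oV Vp; rewrite openZariskiE => -[E VE].
rewrite VE => /existsNP[a /not_implyP[Ea npa]].
exists a => // q nqa; apply: VU; rewrite VE => /(_ a Ea); exact: nqa.
Qed.

Lemma Spec_ext (R : comPzRingType) (p q : Spec R) :
  (forall a, ideal_of p a <-> ideal_of q a) -> p = q.
Proof. by move=> pq; apply/val_inj/funext => a; apply/propext/pq. Qed.

Lemma prime_complement (R : comPzRingType) (p : Spec R) (a : R) :
  ideal_of p a -> ~ ideal_of p (1 - a).
Proof.
move=> pa /(idealD (ideal_ofP p) pa); rewrite addrC subrK.
exact: ideal_proper (ideal_ofP p).
Qed.

(** The product a * (1 - a) vanishes, so it lies in every prime. *)
Lemma prime_idempotent (R : comPzRingType) (p : Spec R) (a : R) :
  a * a = a -> ~ ideal_of p a -> ideal_of p (1 - a).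
Proof.
move=> aa npa; have [//|//] : ideal_of p a \/ ideal_of p (1 - a).
apply: (ideal_prime (ideal_ofP p)); rewrite mulrBr mulr1 aa subrr.
exact: ideal0 (ideal_ofP p).
Qed.

(** An element a lying in only one of two primes separates them, by D(a) and
    D(1 - a). *)
Lemma idempotent_Spec_hausdorff (R : comPzRingType) :
  (forall a : R, a * a = a) -> hausdorff_space (Spec R).
Proof.
move=> idem p q clpq; apply: Spec_ext => a.
have sep (U V : set (Spec R)) : open U -> open V -> U p -> V q ->
    U `&` V !=set0.
  by move=> oU oV Up Vq; apply: clpq; apply: open_nbhs_nbhs.
split=> ha; apply: contrapT => nha.
- have [||r [nr]] := sep _ _ (open_basic (1 - a)) (open_basic a).
  + exact: prime_complement.
  + exact: nha.
  by move=> /(prime_idempotent (idem a)).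
- have [||r [nr]] := sep _ _ (open_basic a) (open_basic (1 - a)).
  + exact: nha.
  + exact: prime_complement.
  by apply; exact: prime_idempotent.
Qed.

(** * Prime ideals of the ring of finite and cofinite sets *)

Section FinCofin.
Variable X : choiceType.
Implicit Types (x : X) (p : Spec (fincofin_ring X)) (A B : fincofin_ring X).

Lemma fincofinP A :
  finite_set (val A : set X) \/ cofinite_set (val A : set X).
Proof. by have /asboolP := valP A. Qed.

Lemma fincofin_ext A B : (forall x, (val A : set X) x <-> (val B : set X) x) ->
  A = B.
Proof. by move=> AB; apply/val_inj/funext => x; apply/propext/AB. Qed.

Lemma fincofin_idem A : A * A = A.
Proof. by apply: val_inj; rewrite rmorphM; exact: setIid. Qed.

Lemma fincofinME A B x :
  (val (A * B) : set X) x <-> (val A : set X) x /\ (val B : set X) x.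
Proof. by rewrite rmorphM. Qed.

Lemma fincofinCE A x : (val (1 - A) : set X) x <-> ~ (val A : set X) x.
Proof.
rewrite rmorphB rmorph1.
change ((([set: X] `\` val A) `|` (val A `\` [set: X])) x <->
  ~ (val A : set X) x).
by split=> [[[]|[_ /(_ I)]]//|nAx]; left.
Qed.

Definition singleton_elt x : fincofin_ring X :=
  FinCofin (asboolT (or_introl (finite_set1 x)) : [set x] \in @fincofin X).

Lemma etaE x A :
  ideal_of (eta x) A <-> ~ (val A : set X) x.
Proof. exact: max_ideal_atE. Qed.

(** Multiplication by {x} detects membership of x: the product of A and {x} is
    {x} if x is in A, and 0 otherwise. *)
Lemma prime_missing_singleton p x :
  ~ ideal_of p (singleton_elt x) -> p = eta x.
Proof.
move=> npx; have hp := ideal_ofP p; apply: Spec_ext => A; rewrite etaE.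
split=> [pA Ax|nAx].
- apply: npx; suff -> : singleton_elt x = singleton_elt x * A.
    exact: idealM.
  by apply: fincofin_ext => y; rewrite fincofinME; split=> [->|[]].
- suff /(ideal_prime hp)[] : ideal_of p (A * singleton_elt x) by [].
  suff -> : A * singleton_elt x = 0 by exact: ideal0.
  apply: fincofin_ext => y; rewrite fincofinME rmorph0.
  by split=> [[Ay yx]|//]; apply: nAx; rewrite -yx.
Qed.

(** A finite set is a sum of singletons. The induction runs over a list that
    only needs to cover A, so that it may list elements outside A or list an
    element twice. *)
Lemma prime_finite p : (forall x, ideal_of p (singleton_elt x)) ->
  forall A, finite_set (val A : set X) -> ideal_of p A.
Proof.
move=> px; have hp := ideal_ofP p.
suff sub (s : seq X) A : (val A : set X) `<=` [set` s] -> ideal_of p A.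
  by move=> A /finite_seqP[s As]; apply: (sub s); rewrite As.
elim: s A => [|x s IHs] A As.
  suff -> : A = 0 by exact: ideal0.
  by apply: fincofin_ext => y; split=> // /As.
(* The head x is split off without deciding whether it belongs to A: the second
   summand is A deprived of x, covered by the tail s. *)
have -> : A = A * singleton_elt x + A * (1 - singleton_elt x).
  by rewrite -mulrDr addrC subrK mulr1.
apply: idealD => //; first exact: idealM.
apply: IHs => y /fincofinME[/As ys /fincofinCE yx].
by move: ys; rewrite /= inE => /predU1P[/yx|].
Qed.

Hypothesis infX : infinite_set [set: X].

Lemma infinite_cofinite (A : set X) : cofinite_set A -> infinite_set A.
Proof.
by move=> cofA finA; apply: infX; rewrite -(setUv A) finite_setU.
Qed.

(** If A and B are both infinite, then they are both cofinite, and so is their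
    intersection, which is then infinite because X is. *)
Lemma finite_ideal_prime :
  prime_ideal [set A : fincofin_ring X | finite_set (val A : set X)].
Proof.
split=> [|A B|A B||A B].
- exact: finite_set0.
- move=> finA finB.
  apply: (@sub_finite_set _ _ ((val A : set X) `|` val B)).
    by move=> x [[]|[]]; [left|right].
  by rewrite finite_setU.
- by apply: sub_finite_set => x /fincofinME[].
- exact: infX.
- have [|cofA] := fincofinP A; first by left.
  have [|cofB] := fincofinP B; first by right.
  move=> finAB; have /infinite_cofinite : cofinite_set (val (A * B) : set X).
    by rewrite setCI finite_setU.
  by [].
Qed.

Definition eta_infty : Spec (fincofin_ring X) := MkSpec finite_ideal_prime.

Lemma fincofin_prime_cases p : p = eta_infty \/ exists x, p = eta x.
Proof.
have [px|/existsNP[x npx]] :=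
  pselect (forall x, ideal_of p (singleton_elt x)); last first.
  by right; exists x; exact: prime_missing_singleton.
left; apply: Spec_ext => A; split; last exact: prime_finite.
move=> pA; change (finite_set (val A : set X)).
have [//|cofA] := fincofinP A.
(* A cofinite A in p would put both A and its finite complement into p. *)
exfalso; apply: (prime_complement pA); apply: prime_finite => //.
by apply: sub_finite_set cofA => x /fincofinCE.
Qed.

(** * The embedding of X and the point at infinity *)

Lemma basic_open_singleton x :
  basic_open (singleton_elt x) = [set eta x].
Proof.
apply/seteqP; split=> [p|_ ->]; first exact: prime_missing_singleton.
by move=> /etaE; apply.
Qed.

(** If A is cofinite, then the only primes containing A are the points eta x
    with x outside A. *)
Lemma eta_infty_nbhs (U : set (Spec (fincofin_ring X))) :
  nbhs eta_infty U -> cofinite_set U.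
Proof.
move=> /nbhs_basic[A infA sAU].
have [//|cofA] := fincofinP A.
apply: sub_finite_set (finite_image (@eta X) cofA) => p nUp.
have pA : ideal_of p A by apply: contrapT => /sAU.
have [pinf|[x px]] := fincofin_prime_cases p.
  by exfalso; apply: infA; rewrite -pinf.
by exists x => //; apply/etaE; rewrite -px.
Qed.

Lemma eta_inj : injective (@eta X).
Proof.
move=> x y xy; apply: contrapT => nxy.
have : ideal_of (eta y) (singleton_elt x) by apply/etaE => /esym.
by rewrite -xy => /etaE; apply.
Qed.

(** The points of the image of eta are isolated, so every subset of the image
    is open. *)
Lemma eta_open (U : set (Spec (fincofin_ring X))) :
  U `<=` range (@eta X) -> open U.
Proof.
move=> sU; have -> : U = \bigcup_(x in @eta X @^-1` U) [set eta x].
  apply/seteqP; split=> [p Up|_ [x Ux ->]//].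
  by have [x _ px] := sU p Up; exists x => //=; rewrite px.
by apply: bigcup_open => x _; rewrite -basic_open_singleton; exact: open_basic.
Qed.

(** A nonempty basic open set D(A) comes from a nonempty set A, and contains
    eta x for every x in A. *)
Lemma eta_dense : dense (range (@eta X)).
Proof.
move=> U [p Up] oU.
have /nbhs_basic[A npA sAU] : nbhs p U by exact: open_nbhs_nbhs.
have [x Ax] : (val A : set X) !=set0.
  apply/set0P/eqP => A0; apply: npA; suff -> : A = 0.
    exact: ideal0 (ideal_ofP p).
  exact: val_inj.
by exists (eta x); split; [apply: sAU => /etaE; apply|exists x].
Qed.

Lemma eta_rangeC : ~` range (@eta X) = [set eta_infty].
Proof.
apply/seteqP; split=> [p nrp|_ -> [x _ xinf]].
  by have [//|[x px]] := fincofin_prime_cases p; case: nrp; exists x.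
have : ideal_of eta_infty (singleton_elt x) by exact: finite_set1.
by rewrite -xinf => /etaE; apply.
Qed.

End FinCofin.

Theorem corollary7p3 (X : choiceType) (infX : infinite_set [set: X]) :
  alexandroff_compactification (@eta X).
Proof.
split; last by exists (eta_infty infX); exact: eta_rangeC.
split.
- split; first exact: compact_cofinite_nbhs (@eta_infty_nbhs X infX).
  exact: idempotent_Spec_hausdorff (@fincofin_idem X).
- split; last by move=> U _; apply: eta_open => _ [x _ <-]; exists x.
    move=> x U /nbhs_singleton Ux.
    by apply: open_nbhs_nbhs; split; [exact: discrete_open|].
  exact: eta_inj.
- exact: eta_dense.
Qed.
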